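(* Let $G=(X,Y,E)$ be a connected convex bipartite graph with $Y$ in convex order and $X$ in lex-convex order, given by its neighbourhood array. The labelling procedure described in the context runs in $\mathcal O(|X|+|E|)$ time.
   Context: A bipartite graph $G=(X,Y,E)$ is convex if $Y$ can be ordered $y_1<\dots<y_{n_Y}$ so that each $N(x)$, $x\in X$, is a set of consecutive vertices; write $left(x)$, $right(x)$ for its smallest and largest neighbour (identifying $y_i$ with index $i$); the neighbourhood array stores $(left(x),right(x))$ for each $x$. The order $x_1<\dots<x_{n_X}$ of $X$ is lex-convex if $i<j$ implies $left(x_i)<left(x_j)$, or $left(x_i)=left(x_j)$ and $right(x_i)\le right(x_j)$. Labelling procedure: set $Label[x]=\infty$, $Count[x]=0$ for all $x\in X$. Enqueue the neighbours of $y_1$ in increasing order into a FIFO queue and set their $Label$ to $0$ and $Count$ to $1$. While the queue is nonempty: dequeue $x$; for every $x_j$ with $x_j>x$, $left(x)<left(x_j)\le right(x)+1\le right(x_j)$ and $Label[x_j]\ge Label[x]+1$: if $Label[x_j]>Label[x]+1$ enqueue $x_j$ (if not already in the queue); set $Label[x_j]\leftarrow Label[x]+1$; set $Count[x_j]\leftarrow Count[x_j]+Count[x]$.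
   Formalization: Executed literally, the procedure can make quadratically many Count updates; proved instead: a unit-cost RAM implementation with the same queue and labels at each iteration, where additions to Count[x] may be grouped until x is dequeued, runs in O(|X|+|E|+1) time. *)

(* Defs.v *)
(* MathComp *)
From mathcomp Require Import all_boot.

Set Implicit Arguments.
Unset Strict Implicit.
Unset Printing Implicit Defensive.

(** * Convex bipartite graphs *)

(* Both sides come already ordered: the vertices x_1 < x_2 < ... of X are
   [0 < 1 < ...] in ['I_(nX G)], and likewise for Y. *)
Record bigraph := BiGraph {
  nX : nat;
  nY : nat;
  adj : 'I_nX -> 'I_nY -> bool }.

Definition nE (G : bigraph) : nat :=
  #|[set p : 'I_(nX G) * 'I_(nY G) | adj p.1 p.2]|.

Definition edge (G : bigraph) : rel ('I_(nX G) + 'I_(nY G)) :=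
  fun u v => match u, v with
  | inl x, inr y | inr y, inl x => adj x y
  | _, _ => false
  end.

Definition connected (G : bigraph) : Prop :=
  forall u v, connect (@edge G) u v.

Definition convex_order (G : bigraph) : Prop :=
  forall (x : 'I_(nX G)) (y1 y2 y3 : 'I_(nY G)),
    y1 <= y2 <= y3 -> adj x y1 -> adj x y3 -> adj x y2.

(* Vertices of Y are numbered from 1 here, so [y.+1] is the index of [y].  In a
   connected graph [x] has no neighbour only if [nX G = 1] and [nY G = 0]; then
   [left x = right x = 0], which is not the index of a vertex. *)
Definition left (G : bigraph) (x : 'I_(nX G)) : nat :=
  \big[minn/nY G]_(y < nY G | adj x y) y.+1.

Definition right (G : bigraph) (x : 'I_(nX G)) : nat :=
  \max_(y < nY G | adj x y) y.+1.

Definition lex_convex_order (G : bigraph) : Prop :=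
  forall i j : 'I_(nX G), i < j ->
    left i < left j \/ (left i = left j /\ right i <= right j).

(** * The labelling procedure *)

(* Labels live in the naturals extended by infinity, [None] being infinity. *)
Definition label := option nat.

Definition label_succ (a : label) : label := omap S a.

Definition label_le (a b : label) : bool :=
  match a, b with
  | _, None => true
  | None, Some _ => false
  | Some m, Some n => m <= n
  end.

Record state (G : bigraph) := State {
  queue : seq 'I_(nX G);
  labels : {ffun 'I_(nX G) -> label};
  counts : {ffun 'I_(nX G) -> nat} }.

Definition first_nbr (G : bigraph) (x : 'I_(nX G)) : bool :=
  [exists y : 'I_(nY G), (y == 0 :> nat) && adj x y].

Definition init_state (G : bigraph) : state G :=
  State [seq x <- enum 'I_(nX G) | first_nbr x]
        [ffun x => if first_nbr x then Some 0 else None]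
        [ffun x => if first_nbr x then 1 else 0].

Definition visit (G : bigraph) (x : 'I_(nX G)) (st : state G) (j : 'I_(nX G)) :
    state G :=
  let l := label_succ (labels st x) in
  if [&& x < j, left x < left j, left j <= (right x).+1,
         (right x).+1 <= right j & label_le l (labels st j)]
  then State
    (if ~~ label_le (labels st j) l && (j \notin queue st)
     then rcons (queue st) j else queue st)
    [ffun i => if i == j then l else labels st i]
    [ffun i => if i == j then counts st j + counts st x else counts st i]
  else st.

(* One iteration of the while loop, [x] having been dequeued and [q] being the
   rest of the queue; "for every x_j" ranges over X in increasing order. *)
Definition iteration (G : bigraph) (st : state G) (x : 'I_(nX G))
    (q : seq 'I_(nX G)) : state G :=
  foldl (visit x) (State q (labels st) (counts st)) (enum 'I_(nX G)).

(** * A random access machine with unit costs *)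

(* The memory consists of arrays of natural numbers indexed by [nat]; a program
   mentions finitely many of them by constant names, so that interleaving them
   gives a single memory with constant-time access.  The instructions are
   those of the usual RAM: constants, addition, truncated subtraction, indirect
   load and store, and tests against 0.  As [counts] may be exponential in
   [nX], unit-cost arithmetic is essential. *)
Definition store := nat -> nat -> nat.

Inductive expr :=
  | Num of nat
  | Read of nat & expr
  | Add of expr & expr
  | Sub of expr & expr.

Inductive cmd :=
  | Skip
  | Write of nat & expr & expr
  | Seq of cmd & cmd
  | If of expr & cmd & cmd
  | While of expr & cmd.

Fixpoint eval (s : store) (e : expr) : nat :=
  match e with
  | Num n => n
  | Read a i => s a (eval s i)
  | Add e1 e2 => eval s e1 + eval s e2
  | Sub e1 e2 => eval s e1 - eval s e2
  end.

Fixpoint cost (e : expr) : nat :=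
  match e with
  | Num _ => 1
  | Read _ i => (cost i).+1
  | Add e1 e2 | Sub e1 e2 => (cost e1 + cost e2).+1
  end.

Definition update (s : store) (a i v : nat) : store :=
  fun b k => if (b == a) && (k == i) then v else s b k.

(* [exec c s t s']: from [s], the command [c] halts in [s'] after [t] steps. *)
Inductive exec : cmd -> store -> nat -> store -> Prop :=
  | exec_skip s : exec Skip s 1 s
  | exec_write a i e s :
      exec (Write a i e) s (cost i + cost e).+1
        (update s a (eval s i) (eval s e))
  | exec_seq c1 c2 s t1 s1 t2 s2 :
      exec c1 s t1 s1 -> exec c2 s1 t2 s2 -> exec (Seq c1 c2) s (t1 + t2) s2
  | exec_if_true e c1 c2 s t s' :
      eval s e != 0 -> exec c1 s t s' -> exec (If e c1 c2) s (cost e + t).+1 s'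
  | exec_if_false e c1 c2 s t s' :
      eval s e = 0 -> exec c2 s t s' -> exec (If e c1 c2) s (cost e + t).+1 s'
  | exec_while_true e c s t1 s1 t2 s2 :
      eval s e != 0 -> exec c s t1 s1 -> exec (While e c) s1 t2 s2 ->
      exec (While e c) s ((cost e).+1 + t1 + t2) s2
  | exec_while_false e c s :
      eval s e = 0 -> exec (While e c) s (cost e).+1 s.

(** * Implementations of the labelling procedure *)

(* Array names; [SIZE], [HEAD] and [TAIL] are scalars stored at index 0. *)
Definition SIZE := 0.
Definition LEFT := 1.
Definition RIGHT := 2.
Definition LABEL := 3.
Definition COUNT := 4.
Definition QUEUE := 5.
Definition HEAD := 6.
Definition TAIL := 7.

Definition tabulate (n : nat) (f : 'I_n -> nat) (k : nat) : nat :=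
  if insub k is Some i then f i else 0.

(* The initial memory holds the neighbourhood array and is 0 elsewhere. *)
Definition input (G : bigraph) : store := fun a k =>
  if a == SIZE then (if k == 0 then nX G else 0)
  else if a == LEFT then tabulate (@left G) k
  else if a == RIGHT then tabulate (@right G) k
  else 0.

Definition label_code (a : label) : nat := if a is Some n then n.+1 else 0.

(* The memory holds the queue, as the segment of the array [QUEUE] between
   [HEAD] (included) and [TAIL] (excluded), and all the labels.  It also holds
   the counts of all vertices that are not waiting in the queue: the procedure
   reads [Count[x]] only when [x] is dequeued, so an implementation may group
   the additions to [Count[x]] and carry them out at that moment.  (Performing
   them one at a time would not be linear: with k vertices of neighbourhood
   {y_1, y_2} and k of neighbourhood {y_2, y_3} there are k ^ 2 additions, but
   only 2 * k vertices in X and 4 * k edges.) *)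
Definition represents (G : bigraph) (st : state G) (s : store) : Prop :=
  [/\ s TAIL 0 = s HEAD 0 + size (queue st),
      forall k, k < size (queue st) ->
        s QUEUE (s HEAD 0 + k) = nth 0 (map val (queue st)) k,
      forall x : 'I_(nX G), s LABEL x = label_code (labels st x)
    & forall x : 'I_(nX G), x \notin queue st -> s COUNT x = counts st x].

Definition queue_nonempty : expr := Sub (Read TAIL (Num 0)) (Read HEAD (Num 0)).

(* [realizes body st s t]: started in [st], the while loop of the procedure
   terminates, and [While queue_nonempty body] started in [s] follows it
   iteration by iteration, representing its state before each test of the loop
   condition, in [t] steps altogether. *)
Inductive realizes (G : bigraph) (body : cmd) :
    state G -> store -> nat -> Prop :=
  | realizes_stop st s :
      represents st s -> queue st = [::] ->
      realizes body st s (cost queue_nonempty).+1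
  | realizes_step st s x q t1 s1 t2 :
      represents st s -> queue st = x :: q ->
      exec body s t1 s1 -> realizes body (iteration st x q) s1 t2 ->
      realizes body st s ((cost queue_nonempty).+1 + t1 + t2).

Lemma realizes_exec (G : bigraph) body (st : state G) s t :
  realizes body st s t -> exists s', exec (While queue_nonempty body) s t s'.
Proof.
elim=> {st s t} [st s [tl _ _ _] q0 | st s x q t1 s1 t2 [tl _ _ _] qE ex _ [s2 IH]].
  by exists s; apply: exec_while_false; rewrite /= tl q0 addn0 subnn.
by exists s2; apply: exec_while_true ex IH; rewrite /= tl qE addKn.
Qed.

(* Main.v *)
Require Import Defs.
From mathcomp Require Import all_boot zify.

(* For l in the interval (left x, right x + 1], the x_j with left x_j = l are
   consecutive in the lex-convex order and sorted by right end, so those reached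
   from x form a suffix of this block, and the vertices of a block that already
   have a label form a suffix as well.  The new vertices of the block are found
   by moving the start of the labelled suffix down, in time one plus their
   number.  There are deg x blocks to treat, and each vertex is new only once.

   Counts are grouped: when x is dequeued, Count[x] is added to one cell for
   each l, the cell being indexed by the label to which x contributes, by l and
   by right x.  When j is dequeued, its count is the sum of the cells of its own
   label with l = left j and left j - 1 <= r < right j, which are deg j many.
   The cells form a three-dimensional array of side N = O(|X| + |E|), which is
   never initialised since the memory starts with zeros.

   Each vertex thus pays for its degree when it is dequeued and one unit when it
   is labelled, and the intervals have total length at most |E| + |X|. *)

Import Defs.

Set Implicit Arguments.
Unset Strict Implicit.
Unset Printing Implicit Defensive.

(** * Timed weakest preconditions *)

Definition wp (c : cmd) (s : store) (Q : nat -> store -> Prop) : Prop :=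
  exists t s', exec c s t s' /\ Q t s'.

Fixpoint writes (c : cmd) : seq nat :=
  match c with
  | Skip => [::]
  | Write a _ _ => [:: a]
  | Seq c1 c2 | If _ c1 c2 => writes c1 ++ writes c2
  | While _ c => writes c
  end.

(** Equality of whole arrays as functions, so that unwritten arrays can be rewritten directly, even
    under an index expression. *)
Definition agree_off (ws : seq nat) (s s' : store) : Prop :=
  forall a, a \notin ws -> s' a = s a.

Lemma exec_agree c s t s' : exec c s t s' -> agree_off (writes c) s s'.
Proof.
elim=> {c s t s'} //=.
- by move=> s a i e b; rewrite inE /update => /negbTE ->.
- by move=> c1 c2 s t1 s1 t2 s2 _ F1 _ F2 a; rewrite mem_cat negb_or => /andP[h1 h2]; rewrite F2 ?F1.
- by move=> e c1 c2 s t s' _ _ F a; rewrite mem_cat negb_or => /andP[h1 h2]; rewrite F.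
- by move=> e c1 c2 s t s' _ _ F a; rewrite mem_cat negb_or => /andP[h1 h2]; rewrite F.
- by move=> e c s t1 s1 t2 s2 _ _ F1 _ F2 a h; rewrite F2 ?F1.
Qed.

(** The consequence rule also supplies the frame condition, so specifications only need to describe
    the arrays that matter. *)
Lemma wp_conseq c s (Q Q' : nat -> store -> Prop) :
  wp c s Q ->
  (forall t s', agree_off (writes c) s s' -> Q t s' -> Q' t s') -> wp c s Q'.
Proof.
by case=> t [s' [ex q]] imp; exists t, s'; split=> //; apply: imp q; apply: exec_agree ex.
Qed.

Lemma wp_write a i e s (Q : nat -> store -> Prop) :
  Q (cost i + cost e).+1 (update s a (eval s i) (eval s e)) ->
  wp (Write a i e) s Q.
Proof. by move=> q; eexists; eexists; split; [apply: exec_write|]. Qed.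

Lemma wp_skip s (Q : nat -> store -> Prop) : Q 1 s -> wp Skip s Q.
Proof. by move=> q; eexists; eexists; split; [apply: exec_skip|]. Qed.

Lemma wp_seq c1 c2 s (Q : nat -> store -> Prop) :
  wp c1 s (fun t1 s1 => wp c2 s1 (fun t2 => Q (t1 + t2))) -> wp (Seq c1 c2) s Q.
Proof.
case=> t1 [s1 [e1 [t2 [s2 [e2 q]]]]].
by exists (t1 + t2), s2; split=> //; apply: exec_seq e1 e2.
Qed.

Lemma wp_if e c1 c2 s (Q : nat -> store -> Prop) :
  (eval s e != 0 -> wp c1 s (fun t => Q (cost e + t).+1)) ->
  (eval s e = 0 -> wp c2 s (fun t => Q (cost e + t).+1)) ->
  wp (If e c1 c2) s Q.
Proof.
move=> h1 h2; have [e0|e1] := eqVneq (eval s e) 0.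
  by case: (h2 e0) => t [s' [ex q]]; eexists; exists s'; split; [apply: exec_if_false ex|].
by case: (h1 e1) => t [s' [ex q]]; eexists; exists s'; split; [apply: exec_if_true ex|].
Qed.

(** [P i t] describes the store after [i] passes and [t] steps. The number [n] of passes is
    announced beforehand, which replaces a termination argument. *)
Lemma wp_while (P : nat -> nat -> store -> Prop) n e c s (Q : nat -> store -> Prop) :
  P 0 0 s ->
  (forall i t s1, i < n -> P i t s1 -> agree_off (writes c) s s1 ->
     eval s1 e != 0 /\
     wp c s1 (fun t' => P i.+1 (t + t' + (cost e).+1))) ->
  (forall t s1, P n t s1 -> agree_off (writes c) s s1 ->
     eval s1 e = 0 /\ Q (t + (cost e).+1) s1) ->
  wp (While e c) s Q.
Proof.
move=> P0 step last.
suff loop m i t s1 : i + m = n -> P i t s1 -> agree_off (writes c) s s1 ->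
    wp (While e c) s1 (fun t' => Q (t + t')) by apply: (loop n 0 0).
elim: m i t s1 => [|m IH] i t s1.
  rewrite addn0 => -> Pi fr; have [e0 q] := last _ _ Pi fr.
  by eexists; exists s1; split; [apply: exec_while_false|].
move=> im Pi fr; have lt_in : i < n by lia.
have [e1 [t1 [s2 [ex1 P1]]]] := step _ _ _ lt_in Pi fr.
have fr2 : agree_off (writes c) s s2.
  by move=> a h; rewrite (exec_agree ex1 h) fr.
have [|t2 [s3 [ex2 q]]] := IH i.+1 _ s2 _ P1 fr2; first by lia.
eexists; exists s3; split; first exact: exec_while_true ex1 ex2.
by rewrite (_ : t + _ = t + t1 + (cost e).+1 + t2) //; lia.
Qed.

(** * The program *)

(* [VISITED] gives the start of the labelled suffix of each block, [ACC] holds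
   the cells, [KEY] gives N ^ 2 times the label of each labelled vertex, and
   [MULT] the multiples of N, which is stored in [BASE]. *)
Definition VISITED := 8.
Definition ACC := 9.
Definition KEY := 10.
Definition MULT := 11.
Definition BASE := 12.
Definition CUR := 13.
Definition ROW := 14.
Definition COL := 15.
Definition LO := 16.
Definition HI := 17.

Definition var a := Read a (Num 0).
Definition assign a e := Write a (Num 0) e.
Definition incr a := assign a (Add (var a) (Num 1)).

(** The machine has no multiplication, so the offset of a row is read from a table. *)
Definition slot row col : expr := Add (Read MULT row) col.

Definition collect : cmd :=
  Seq (assign COL (Sub (Read LEFT (var CUR)) (Num 1)))
  (While (Sub (Read RIGHT (var CUR)) (var COL))
    (Seq (Write COUNT (var CUR)
            (Add (Read COUNT (var CUR))
               (Read ACC (Add (Read KEY (var CUR))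
                              (slot (Read LEFT (var CUR)) (var COL))))))
         (incr COL))).

(** This is [N * N]; it is the reason why the table [MULT] extends to the index [N]. *)
Definition square_base : expr := Read MULT (var BASE).

Definition next_key : expr := Add (Read KEY (var CUR)) square_base.

Definition distribute : cmd :=
  let a := Add next_key (slot (var ROW) (Read RIGHT (var CUR))) in
  Write ACC a (Add (Read ACC a) (Read COUNT (var CUR))).

Definition before_lo : expr := Sub (var LO) (Num 1).

(* Conjunction of [LEFT[LO - 1] >= ROW] and [RIGHT[LO - 1] > RIGHT[CUR]].  At
   [LO = 0] the index [LO - 1] is 0, and the first test fails because
   [LEFT[0] <= LEFT[CUR] < ROW]. *)
Definition scan_test : expr :=
  Sub (Num 1)
    (Add (Sub (Num 1) (Sub (Add (Read LEFT before_lo) (Num 1)) (var ROW)))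
         (Sub (Num 1) (Sub (Read RIGHT before_lo) (Read RIGHT (var CUR))))).

Definition scan : cmd := While scan_test (assign LO before_lo).

Definition enqueue : cmd :=
  While (Sub (var HI) (var LO))
    (Seq (Write QUEUE (var TAIL) (var LO))
    (Seq (incr TAIL)
    (Seq (Write LABEL (var LO) (Add (Read LABEL (var CUR)) (Num 1)))
    (Seq (Write KEY (var LO) next_key)
         (incr LO))))).

(** The pointer is saved before [enqueue], which moves [LO] up to [HI]. *)
Definition treat_row : cmd :=
  Seq distribute
  (Seq (assign HI (Read VISITED (var ROW)))
  (Seq (assign LO (var HI))
  (Seq scan
  (Seq (Write VISITED (var ROW) (var LO))
  (Seq enqueue
       (incr ROW)))))).

Definition body : cmd :=
  Seq (assign CUR (Read QUEUE (var HEAD)))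
  (Seq (incr HEAD)
  (Seq collect
  (Seq (assign ROW (Add (Read LEFT (var CUR)) (Num 1)))
       (While (Sub (Add (Read RIGHT (var CUR)) (Num 2)) (var ROW)) treat_row)))).

Lemma updateE s a i v k : update s a i v a k = if k == i then v else s a k.
Proof. by rewrite /update eqxx. Qed.

Lemma update_ne s a i v b : b != a -> update s a i v b = s b.
Proof. by rewrite /update => /negbTE ->. Qed.

(** * Effect and running time of one pass of the main loop *)

Section Body.

Variables (n N : nat) (lf rt : nat -> nat).

Hypothesis lex : forall i j, i < j -> j < n -> lf i < lf j \/ (lf i = lf j /\ rt i <= rt j).
Hypothesis lf_gt0 : forall i, i < n -> 0 < lf i.
Hypothesis lf_le_rt : forall i, i < n -> lf i <= rt i.
Hypothesis rt_lt : forall i, i < n -> (rt i).+1 < N.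

(** The comparison [x < j] made by [visit] follows from [lf x < lf j], by [lf_lt]. *)
Definition arc x j := [&& lf x < lf j, lf j <= (rt x).+1 & rt x < rt j].

Definition tables s :=
  [/\ s LEFT = lf, s RIGHT = rt, s BASE 0 = N & forall i, i <= N -> s MULT i = i * N].

(* The block of [l = 1] is excluded: it is labelled from the start, and its
   pointer is never read. *)
Definition visited_ok (vis lab : nat -> nat) :=
  forall l, 1 < l ->
    (forall k, k < vis l -> k < n /\ lf k <= l) /\
    (forall k, k < n -> lf k = l -> (lab k == 0) = (k < vis l)).

Lemma lf_mono i j : i <= j -> j < n -> lf i <= lf j.
Proof. by rewrite leq_eqVlt => /predU1P[-> //|ij] jn; case: (lex ij jn) => [/ltnW|[->]]. Qed.

Lemma lf_lt i j : i < n -> lf i < lf j -> i < j.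
Proof. by move=> jn h; rewrite ltnNge; apply/negP => /lf_mono /(_ jn); lia. Qed.

(** While [x] waits, [COUNT] still holds its initial value, 1 for a source and 0 otherwise; the sum
    adds the grouped contributions to it. *)
Definition gathered s x :=
  s COUNT x + \sum_((lf x).-1 <= r < rt x) s ACC (s KEY x + (lf x * N + r)).

Lemma collect_spec s x :
  x < n -> tables s -> s CUR 0 = x ->
  wp collect s (fun t s' => t <= 40 * (rt x - lf x + 2) /\
     forall j, s' COUNT j = if j == x then gathered s x else s COUNT j).
Proof.
move=> xn [sL sR sB sM] sC.
have lfx := lf_gt0 xn; have rtx := rt_lt xn; have lrx := lf_le_rt xn.
apply: wp_seq; apply: wp_write => /=.
set s0 := update _ _ _ _.
pose lo := (lf x).-1.
apply: (@wp_while (fun i t s1 => [/\ t <= i * 40, s1 COL 0 = lo + i &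
   forall j, s1 COUNT j = if j == x
     then s COUNT x + \sum_(lo <= r < lo + i) s ACC (s KEY x + (lf x * N + r))
     else s COUNT j]) (rt x - lo)).
- split=> //; first by rewrite addn0 /s0 /update /= sL sC /lo; lia.
  move=> j; rewrite addn0 big_geq // addn0 /s0 update_ne //.
  by case: eqP => [->|].
- move=> i t s1 lti [ht hc hcount] fr.
  have f a : a \notin [:: COUNT; COL] -> s1 a = s a.
    move=> h; rewrite fr //; rewrite /s0 update_ne //.
    by apply: contraNneq h => ->.
  split.
    rewrite /= !(f RIGHT, f CUR, f LEFT, f KEY, f MULT, f ACC) // sR sC hc.
    by rewrite /lo in lti *; lia.
  apply: wp_seq; apply: wp_write; apply: wp_write => /=.
  rewrite /update /= !(f RIGHT, f CUR, f LEFT, f KEY, f MULT, f ACC) // sL sC.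
  split; [by lia | by rewrite hc; lia |].
  move=> j; rewrite !hcount eqxx; case: eqP => // _.
  rewrite hc addnS big_nat_recr /=; last by lia.
  by rewrite sM; [lia | lia].
- move=> t s1 [ht hc hcount] fr.
  have f a : a \notin [:: COUNT; COL] -> s1 a = s a.
    move=> h; rewrite fr //; rewrite /s0 update_ne //.
    by apply: contraNneq h => ->.
  split; first by rewrite /= !(f RIGHT, f CUR, f LEFT, f KEY, f MULT, f ACC) // sR sC hc /lo; lia.
  split; first by rewrite /=; lia.
  move=> j; rewrite hcount /gathered; congr (if _ then _ + _ else _).
  by congr bigop; rewrite /index_iota -/lo; congr iota; lia.
Qed.


(** Finds in advance where a downward scan from [w] halts, since [wp_while] asks for the number of
    passes. *)
Lemma stop_point (good : pred nat) w :
  exists2 v, v <= w &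
    (forall k, v <= k < w -> good k) /\ (v = 0 \/ ~~ good v.-1).
Proof.
elim: w => [|w [v vw [hg hs]]]; first by exists 0 => //; split=> [k|]; [lia | left].
have [gw|ngw] := boolP (good w).
  have [vE|vE] := eqVneq v w.
    exists v; first by lia.
    split=> // k kw; have -> : k = w by lia.
    by [].
  by exists v; [lia | split=> // k kw; have [->//|?] := eqVneq k w; apply: hg; lia].
by exists w.+1 => //; split=> [k|]; [lia | right].
Qed.

(** Below [w] all values of [lf] are at most [l], so the test [l <= lf k] selects block [l]. Right
    ends increase within the block, so the first failure settles all smaller indices. *)
Lemma scan_spec s x l w :
  x < n -> s LEFT = lf -> s RIGHT = rt -> s CUR 0 = x -> s ROW 0 = l ->
  lf x < l -> (forall k, k < w -> k < n /\ lf k <= l) -> s LO 0 = w ->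
  wp scan s (fun t s' => exists v,
    [/\ v <= w, t <= 40 * (w - v + 1), s' LO 0 = v,
        forall k, v <= k < w -> lf k = l /\ rt x < rt k &
        forall k, k < v -> lf k = l -> rt k <= rt x]).
Proof.
move=> xn sL sR sC sW lx vis sw.
have [v vw [hg hs]] := stop_point (fun k => (l <= lf k) && (rt x < rt k)) w.
have fr_ s1 : agree_off (writes scan) s s1 ->
    [/\ s1 LEFT = lf, s1 RIGHT = rt, s1 CUR 0 = x & s1 ROW 0 = l].
  by move=> fr; rewrite !(fr LEFT, fr RIGHT, fr CUR, fr ROW).
apply: (@wp_while (fun i t s1 => t <= i * 40 /\ s1 LO 0 = w - i) (w - v)).
- by rewrite sw; lia.
- move=> i t s1 iv [ht hl] /fr_[fL fR fC fW].
  split.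
    rewrite /= fL fR fC fW hl.
    by have /andP[] := hg (w - i - 1) ltac:(lia); lia.
  by apply: wp_write; rewrite /update /= hl; lia.
- move=> t s1 [ht hl] /fr_[fL fR fC fW].
  have vE : w - (w - v) = v by lia.
  split.
    rewrite /= fL fR fC fW hl vE subn1.
    case: hs => [->|hs]; last by lia.
    by have := lf_mono (leq0n x) xn; rewrite /=; lia.
  exists v; split=> //; [by rewrite /=; lia | by lia | |].
    by move=> k kv; have /andP[? ?] := hg _ kv; have [|_ ?] := vis k; [lia | split; lia].
  move=> k kv lk.
  case: hs => [|hs]; first lia.
  have [] := vis v.-1; first lia.
  move=> vn lv; move: hs; rewrite negb_and -ltnNge -leqNgt => hs.
  have [kE|kv'] := eqVneq k v.-1; first by rewrite -kE lk in hs; lia.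
  have kv1 : k < v.-1 by lia.
  by have := lex kv1 vn; lia.
Qed.

(** The premise [~~ (v <= x < w)] keeps [LABEL[x]] and [KEY[x]], which every pass reads,
    constant. *)
Lemma enqueue_spec s x v w :
  s CUR 0 = x -> s MULT (s BASE 0) = N * N -> ~~ (v <= x < w) ->
  s LO 0 = v -> s HI 0 = w -> v <= w ->
  wp enqueue s (fun t s' =>
    [/\ t <= 60 * (w - v) + 40,
        s' TAIL 0 = s TAIL 0 + (w - v),
        forall k, s' QUEUE k = if s TAIL 0 <= k < s TAIL 0 + (w - v)
                               then v + (k - s TAIL 0) else s QUEUE k,
        forall j, s' LABEL j = if v <= j < w then (s LABEL x).+1 else s LABEL j &
        forall j, s' KEY j = if v <= j < w then s KEY x + N * N else s KEY j]).
Proof.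
move=> sC sNN xnew sv sw vw.
have fr_ s1 : agree_off (writes enqueue) s s1 ->
    [/\ s1 CUR 0 = x, s1 MULT (s1 BASE 0) = N * N & s1 HI 0 = w].
  by move=> fr; rewrite !(fr CUR, fr MULT, fr BASE, fr HI).
apply: (@wp_while (fun i t s1 => 
    [/\ t <= 60 * i /\ s1 LO 0 = v + i,
        s1 TAIL 0 = s TAIL 0 + i,
        forall k, s1 QUEUE k = if s TAIL 0 <= k < s TAIL 0 + i
                               then v + (k - s TAIL 0) else s QUEUE k,
        forall j, s1 LABEL j = if v <= j < v + i then (s LABEL x).+1 else s LABEL j &
        forall j, s1 KEY j = if v <= j < v + i then s KEY x + N * N else s KEY j]) (w - v)).
- rewrite !addn0; split=> // k; case: ifP => //; lia.
- move=> i t s1 iw [[ht hlo] htl hq hl hk] /fr_[fC fNN fH].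
  split; first by rewrite /= fH hlo; lia.
  do !(apply: wp_seq; apply: wp_write); apply: wp_write => /=.
  rewrite /update /= fC fNN hlo htl; split.
  + by split; lia.
  + by lia.
  + by move=> k; rewrite hq; case: eqP => [->|kt]; repeat case: ifP => ?; lia.
  + move=> j; rewrite !hl; have -> : (v <= x < v + i) = false by lia.
    by case: eqP => [->|jt]; repeat case: ifP => ?; lia.
  + move=> j; rewrite !hk; have -> : (v <= x < v + i) = false by lia.
    by case: eqP => [->|jt]; repeat case: ifP => ?; lia.
- move=> t s1 [[ht hlo] htl hq hl hk] /fr_[fC fNN fH].
  have vE : v + (w - v) = w by lia.
  rewrite vE in hlo hl hk.
  by split; [rewrite /= fH hlo; lia | split=> //=; lia].
Qed.

(** Filtering [iota] lists the new vertices in increasing order, the order in which [visit] enqueues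
    them. *)
Definition news (lab : nat -> nat) x l :=
  [seq j <- iota 0 n | [&& lab j == 0, arc x j & lf j < l]].

Lemma mem_news lab x l j :
  (j \in news lab x l) = [&& j < n, lab j == 0, arc x j & lf j < l].
Proof. by rewrite mem_filter mem_iota add0n /= andbC. Qed.

(** As [key] is a multiple of [N * N], this is a number whose last two digits in base [N] are [l]
    and [r]; the summand [N * N] passes to the next label. *)
Definition address key l r := key + N * N + (l * N + r).

Definition targets key x l := [seq address key i (rt x) | i <- index_iota (lf x).+1 l].

(** [s0] is the store on entry to the loop over the rows and [l] the next row to treat. *)
Record row_inv s0 x l s1 : Prop := RowInv {
  inv_row : s1 ROW 0 = l;
  inv_tail : s1 TAIL 0 = s0 TAIL 0 + size (news (s0 LABEL) x l);
  inv_queue k : s1 QUEUE k =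
    if s0 TAIL 0 <= k < s0 TAIL 0 + size (news (s0 LABEL) x l)
    then nth 0 (news (s0 LABEL) x l) (k - s0 TAIL 0) else s0 QUEUE k;
  inv_label j : s1 LABEL j =
    if j \in news (s0 LABEL) x l then (s0 LABEL x).+1 else s0 LABEL j;
  inv_key j : s1 KEY j =
    if j \in news (s0 LABEL) x l then s0 KEY x + N * N else s0 KEY j;
  inv_acc k : s1 ACC k =
    s0 ACC k + (if k \in targets (s0 KEY x) x l then s0 COUNT x else 0);
  inv_visited : visited_ok (s1 VISITED) (s1 LABEL) }.

(** A row costs one unit plus one per vertex it labels. The bound is written without subtraction and
    telescopes over the rows. *)
Lemma row_spec s0 s x l :
  x < n -> tables s0 -> s0 CUR 0 = x -> agree_off (writes treat_row) s0 s ->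
  lf x < l <= (rt x).+1 -> row_inv s0 x l s ->
  wp treat_row s (fun t s' => row_inv s0 x l.+1 s' /\
     t + 200 * size (news (s0 LABEL) x l) <=
       200 * (size (news (s0 LABEL) x l.+1)).+1).
Proof.
move=> xn tb sC0 fr lxr inv.
have [sL sR sN sM] : tables s.
  by case: tb => tL tR tN tM; split; rewrite ?(fr LEFT, fr RIGHT, fr BASE, fr MULT).
have sC : s CUR 0 = x by rewrite (fr CUR).
have sCn : s COUNT = s0 COUNT by rewrite (fr COUNT).
have [sW sT sQ sLa sK sA sV] := inv.
have rtx := rt_lt xn; have lfx := lf_gt0 xn.
set lab0 := s0 LABEL in sT sQ sLa sK sA *.
have xnew l' : (x \in news lab0 x l') = false.
  by rewrite mem_news /arc ltnn !andbF.
have l1 : 1 < l by lia.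
have [vis1 vis2] := sV _ l1.
apply: wp_seq; apply: wp_write.
apply: wp_seq; apply: wp_write.
apply: wp_seq; apply: wp_write.
apply: wp_seq.
set s1 := (X in wp scan X).
have fr1 a : a \notin [:: ACC; HI; LO] -> s1 a = s a.
  by rewrite !inE !negb_or => /and3P[? ? ?]; rewrite /s1 !update_ne.
have s1A k : s1 ACC k = s0 ACC k + (if k \in targets (s0 KEY x) x l.+1 then s0 COUNT x else 0).
  rewrite /s1 /update /= sC sW sR sN !sM ?leqnn; [|lia..].
  rewrite sK xnew !sA sCn.
  rewrite /targets /index_iota (_ : l.+1 - (lf x).+1 = l - (lf x).+1 + 1); last by lia.
  rewrite iotaD map_cat mem_cat /= subnKC; last by lia.
  rewrite inE -/(address _ _ _).
  case: eqP => [->|_]; last by rewrite orbF.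
  rewrite orbT ifN ?addn0 //.
  (* The address of row [l] differs from those of the earlier rows, so each cell is increased only
     once. *)
  apply/mapP => -[i]; rewrite mem_iota /address => il /eqP.
  have N0 : 0 < N by lia.
  by rewrite eqn_add2l eqn_add2r eqn_pmul2r //; lia.
have s1H : s1 HI 0 = s VISITED l by rewrite /s1 /update /= sW.
have s1O : s1 LO 0 = s VISITED l by rewrite /s1 /update /= sW.
move: s1 => s1 in fr1 s1A s1H s1O *.
apply: (wp_conseq (scan_spec xn _ _ _ _ _ vis1 s1O)); rewrite ?fr1 //; first by lia.
move=> t1 s2 fr2 [v [vw ht1 s2O good stop]].
set w := s VISITED l in vis1 vis2 s1H s1O vw ht1 good stop *.
(* Both sides are strictly increasing, so comparing members suffices. Vertices of earlier rows have
   smaller [lf], hence smaller indices. *)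
have new_cat : news lab0 x l.+1 = news lab0 x l ++ iota v (w - v).
  apply: (irr_sorted_eq ltn_trans ltnn).
  - by apply: sorted_filter; [exact: ltn_trans | exact: iota_ltn_sorted].
  - rewrite (sorted_pairwise ltn_trans) pairwise_cat -!(sorted_pairwise ltn_trans).
    rewrite iota_ltn_sorted sorted_filter ?iota_ltn_sorted ?andbT //; last exact: ltn_trans.
    apply/allrelP => i j; rewrite mem_news mem_iota => /and4P[in_ _ _ il] jv.
    have [|ln _] := good j; first by lia.
    have [|jn _] := vis1 j; first by lia.
    by apply: lf_lt => //; lia.
  - move=> j; rewrite mem_cat !mem_news mem_iota.
    have [ll|ll] := eqVneq (lf j) l.
      rewrite ll ltnn !andbF ltnSn andbT /=.
      rewrite subnKC //.
      (* In block [l], being unlabelled means lying below [w], by [vis2]; then [stop] excludes the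
         indices below [v]. *)
      apply/idP/idP.
        case/and3P=> jn lj /and3P[_ _ rj].
        have := vis2 j jn ll; rewrite sLa mem_news ll ltnn !andbF lj => /esym jw.
        rewrite jw andbT leqNgt; apply/negP => /stop /(_ ll); lia.
      move=> jv; have [_ rj] := good _ jv.
      have [|jn _] := vis1 j; first by lia.
      have := vis2 j jn ll; rewrite sLa mem_news ll ltnn !andbF => ->.
      by rewrite /arc ll jn rj; lia.
    have -> : (lf j < l.+1) = (lf j < l) by lia.
    have -> : (v <= j < v + (w - v)) = false; last by rewrite orbF.
    by apply/negP => jv; have [|] := good j; lia.
have sz : size (news lab0 x l.+1) = size (news lab0 x l) + (w - v).
  by rewrite new_cat size_cat size_iota.
have fr2' a : a \notin [:: LO] -> s2 a = s1 a by move=> h; rewrite fr2.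
apply: wp_seq; apply: wp_write.
set s3 := (X in wp _ X).
have fr3 a : a \notin [:: VISITED] -> s3 a = s2 a.
  by rewrite inE => ?; rewrite /s3 update_ne.
have s3V k : s3 VISITED k = if k == l then v else s VISITED k.
  by rewrite /s3 updateE /= fr2' // fr1 // sW s2O fr2' // fr1.
move: s3 => s3 in fr3 s3V *.
have fr13 a : a \notin [:: ACC; HI; LO; VISITED] -> s3 a = s a.
  rewrite !inE !negb_or => /and4P[? ? ? ?].
  by rewrite fr3 ?fr2' ?fr1 ?inE ?negb_or //; apply/and3P.
apply: wp_seq.
apply: (wp_conseq (@enqueue_spec _ x v w _ _ _ _ _ vw)).
- by rewrite fr13.
- by rewrite !fr13 // sM sN.
- apply/negP => /good[ll _]; lia.
- by rewrite fr3.
- by rewrite fr3 // fr2'.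
move=> t2 s4 fr4 [ht2 s4T s4Q s4L s4K].
rewrite !fr13 // in s4T s4Q s4L s4K.
apply: wp_write; split; last by rewrite sz /=; lia.
have in_new j : (j \in news lab0 x l.+1) = (j \in news lab0 x l) || (v <= j < w).
  by rewrite new_cat mem_cat mem_iota subnKC.
have labE j : s4 LABEL j = if j \in news lab0 x l.+1 then (lab0 x).+1 else lab0 j.
  by rewrite s4L !sLa xnew in_new orbC; case: ifP.
split.
- by rewrite updateE /= (fr4 ROW) // fr13 // sW addn1.
- by rewrite update_ne // s4T sT sz addnA.
- move=> k; rewrite update_ne // s4Q sQ sT sz -/lab0 new_cat nth_cat.
  rewrite addnA; case: ifP => h1.
    rewrite ifT; last by lia.
    rewrite ifF; last by lia.
    rewrite nth_iota; lia.
  case: ifP => h2; first by rewrite ifT ?ifT //; lia.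
  by rewrite ifF //; lia.
- by move=> j; rewrite update_ne // labE.
- by move=> j; rewrite update_ne // s4K !sK xnew -/lab0 in_new orbC; case: ifP.
- by move=> k; rewrite update_ne // (fr4 ACC) // fr3 // fr2'.
(* Only block [l] changes: its pointer drops to [v], and exactly the indices from [v] to [w - 1]
   receive labels. *)
- rewrite !update_ne // => l' l'1; rewrite (fr4 VISITED) //.
  have [h1 h2] := sV l' l'1.
  split=> [k|k kn lk]; rewrite s3V; have [l'E|l'E] := eqVneq l' l.
  + by move=> kv; rewrite l'E; apply: vis1; lia.
  + exact: h1.
  + have lkl : lf k = l by rewrite lk.
    rewrite s4L; have := vis2 k kn lkl.
    case: ifP => [kv _|kv ->]; first by lia.
    by lia.
  + rewrite s4L ifN; first exact: h2.
    by apply/negP => /good[]; rewrite lk => /eqP; rewrite (negbTE l'E).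
Qed.

Definition next_vertex s := s QUEUE (s HEAD 0).

(** The bound [(rt x).+2] is exclusive: the last row treated is [rt x + 1]. *)
Record body_post s x t s' : Prop := BodyPost {
  post_time : t <= 400 * (rt x - lf x + size (news (s LABEL) x (rt x).+2)).+1;
  post_head : s' HEAD 0 = (s HEAD 0).+1;
  post_tail : s' TAIL 0 = s TAIL 0 + size (news (s LABEL) x (rt x).+2);
  post_queue k : s' QUEUE k =
    if s TAIL 0 <= k < s TAIL 0 + size (news (s LABEL) x (rt x).+2)
    then nth 0 (news (s LABEL) x (rt x).+2) (k - s TAIL 0) else s QUEUE k;
  post_label j : s' LABEL j =
    if j \in news (s LABEL) x (rt x).+2 then (s LABEL x).+1 else s LABEL j;
  post_key j : s' KEY j =
    if j \in news (s LABEL) x (rt x).+2 then s KEY x + N * N else s KEY j;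
  post_count j : s' COUNT j = if j == x then gathered s x else s COUNT j;
  post_acc k : s' ACC k =
    s ACC k + (if k \in targets (s KEY x) x (rt x).+2 then gathered s x else 0);
  post_visited : visited_ok (s' VISITED) (s' LABEL);
  post_tables : tables s' }.

Lemma body_spec s x :
  x < n -> tables s -> visited_ok (s VISITED) (s LABEL) -> next_vertex s = x ->
  wp body s (body_post s x).
Proof.
move=> xn tb sV sx.
have lfx := lf_gt0 xn; have rtx := rt_lt xn; have lrx := lf_le_rt xn.
have [sL sR sN sM] := tb.
apply: wp_seq; apply: wp_write.
apply: wp_seq; apply: wp_write.
apply: wp_seq.
set s1 := (X in wp _ X).
have fr1 a : a \notin [:: CUR; HEAD] -> s1 a = s a.
  by rewrite !inE !negb_or => /andP[? ?]; rewrite /s1 !update_ne.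
have s1C : s1 CUR 0 = x by rewrite /s1 /update /= -sx.
have s1H : s1 HEAD 0 = (s HEAD 0).+1 by rewrite /s1 /update /= addn1.
move: s1 => s1 in fr1 s1C s1H *.
have tb1 : tables s1 by split; rewrite ?fr1.
apply: (wp_conseq (collect_spec xn tb1 s1C)) => t2 s2 fr2 [ht2 s2Cn].
have gE : gathered s1 x = gathered s x by rewrite /gathered !fr1.
rewrite gE in s2Cn.
apply: wp_seq; apply: wp_write.
set s3 := (X in wp _ X).
have fr3 a : a \notin [:: CUR; HEAD; COUNT; COL; ROW] -> s3 a = s a.
  by rewrite !inE !negb_or => /and5P[? ? ? ? ?]; rewrite /s3 update_ne // fr2 /= ?fr1 ?inE ?negb_or; do ?[apply/andP; split].
have s3C : s3 CUR 0 = x by rewrite /s3 update_ne // fr2.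
have s3H : s3 HEAD 0 = (s HEAD 0).+1 by rewrite /s3 update_ne // fr2.
have s3Cn j : s3 COUNT j = if j == x then gathered s x else s COUNT j.
  by rewrite /s3 update_ne // s2Cn fr1.
have s3W : s3 ROW 0 = (lf x).+1.
  by rewrite /s3 updateE /= !fr2 // s1C fr1 // sL addn1.
move: s3 => s3 in fr3 s3C s3H s3Cn s3W *.
have tb3 : tables s3 by split; rewrite ?fr3.
have new0 lab : news lab x (lf x).+1 = [::].
  apply/eqP; rewrite -(negbK (_ == _)) -has_filter.
  by apply/hasPn => j _; apply/and3P => -[_ /and3P[]]; lia.
(* Each row and each new vertex is charged 200, by [row_spec]; the other 50 per row cover the loop
   test. *)
apply: (@wp_while (fun i t s4 => row_inv s3 x ((lf x).+1 + i) s4 /\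
   t <= 250 * i + 200 * size (news (s LABEL) x ((lf x).+1 + i))) ((rt x).+1 - lf x)).
- rewrite addn0; split=> //; split; rewrite ?new0 //.
  + by rewrite addn0.
  + by move=> k; rewrite ifF //; apply/negP; rewrite /=; lia.
  + by move=> k; rewrite /targets /index_iota subnn addn0.
  + by rewrite !fr3.
- move=> i t s4 it [inv ht] fr4.
  have s4C : s4 CUR 0 = x by rewrite fr4.
  split.
    by rewrite /= s4C (fr4 RIGHT) // fr3 // sR (inv_row inv); lia.
  apply: (wp_conseq (row_spec xn tb3 s3C fr4 _ inv)); first by lia.
  move=> t' s5 fr5 [inv5 ht5]; rewrite addnS; split=> //.
  by rewrite fr3 // in ht5; rewrite /=; lia.
move=> t s4 []; rewrite addSn subnKC; last by lia.
move=> inv ht fr4.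
have s4C : s4 CUR 0 = x by rewrite fr4.
split; first by rewrite /= s4C (fr4 RIGHT) // fr3 // sR (inv_row inv); lia.
case: inv => _ i2 i3 i4 i5 i6 i7.
rewrite !(fr3 TAIL, fr3 QUEUE, fr3 LABEL, fr3 KEY, fr3 ACC) // in i2 i3 i4 i5 i6.
split=> //.
- by rewrite /=; lia.
- by rewrite fr4.
- by move=> j; rewrite fr4.
- by move=> k; rewrite i6 s3Cn eqxx.
- by split; rewrite fr4 // fr3.
Qed.


(* [a - ((a - 1) + (a - 1))] is nonzero only for [a = 1]. *)
Definition setup : cmd :=
  Seq (While (Sub (var SIZE) (var ROW))
        (Seq (assign BASE (Add (var BASE) (Sub (Add (Read RIGHT (var ROW)) (Num 1))
                                            (Read LEFT (var ROW)))))
        (Seq (Write VISITED (Read LEFT (var ROW)) (Add (var ROW) (Num 1)))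
        (Seq (If (Sub (Read LEFT (var ROW))
                      (Add (Sub (Read LEFT (var ROW)) (Num 1))
                           (Sub (Read LEFT (var ROW)) (Num 1))))
               (Seq (Write QUEUE (var TAIL) (var ROW))
               (Seq (incr TAIL)
               (Seq (Write LABEL (var ROW) (Num 1))
                    (Write COUNT (var ROW) (Num 1)))))
               Skip)
             (incr ROW)))))
  (Seq (assign BASE (Add (var BASE) (Add (var SIZE) (Num 2))))
  (Seq (assign ROW (Num 0))
       (While (Sub (var BASE) (var ROW))
         (Seq (Write MULT (Add (var ROW) (Num 1)) (Add (Read MULT (var ROW)) (var BASE)))
              (incr ROW))))).

(** * Correctness of the initialisation *)

Definition sources m := [seq j <- iota 0 m | lf j == 1].

Record setup_post t s' : Prop := SetupPost {
  setup_time : t <= 200 * N;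
  setup_head : s' HEAD 0 = 0;
  setup_tail : s' TAIL 0 = size (sources n);
  setup_queue k : k < size (sources n) -> s' QUEUE k = nth 0 (sources n) k;
  setup_label k : s' LABEL k = (k \in sources n);
  setup_count k : s' COUNT k = (k \in sources n);
  setup_key k : s' KEY k = 0;
  setup_acc k : s' ACC k = 0;
  setup_visited : visited_ok (s' VISITED) (s' LABEL);
  setup_tables : tables s' }.

(** Each vertex overwrites the [VISITED] pointer of its block, which thus ends just past the last
    vertex; an empty block keeps 0. The loops make [n] and [N] passes, and [N] exceeds [n]. *)
Lemma setup_spec s :
  N = \sum_(0 <= i < n) ((rt i).+1 - lf i) + n + 2 ->
  s SIZE 0 = n -> s LEFT = lf -> s RIGHT = rt ->
  (forall a k, RIGHT < a -> s a k = 0) ->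
  wp setup s setup_post.
Proof.
move=> NE sn sL sR s0.
apply: wp_seq.
apply: (@wp_while (fun i t s1 =>
  [/\ t <= 100 * i /\ s1 ROW 0 = i,
      s1 BASE 0 = \sum_(0 <= j < i) ((rt j).+1 - lf j),
      s1 TAIL 0 = size (sources i) /\
        (forall k, k < size (sources i) -> s1 QUEUE k = nth 0 (sources i) k),
      (forall k, s1 LABEL k = (k \in sources i)) /\
      (forall k, s1 COUNT k = (k \in sources i)) &
      forall l k, (k < s1 VISITED l -> k < i /\ lf k <= l) /\
                  (k < i -> lf k = l -> k < s1 VISITED l)]) n).
- rewrite !s0 // big_geq //; split=> //; try by split=> // k; rewrite s0.
  by move=> l k; rewrite s0.
- move=> i t s1 it [[ht hr] hb [htl hq] [hl hc] hv] fr.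
  rewrite /= in fr.
  split; first by rewrite /= (fr SIZE) // sn hr; lia.
  apply: wp_seq; apply: wp_write => /=.
  apply: wp_seq; apply: wp_write => /=.
  apply: wp_seq.
  set s2 := update _ VISITED _ _.
  have s2L : s2 LEFT = lf by rewrite -sL -(fr LEFT).
  have s2W : s2 ROW 0 = i by rewrite -hr.
  have hv2 l k : (k < s2 VISITED l -> k < i.+1 /\ lf k <= l) /\
                  (k < i.+1 -> lf k = l -> k < s2 VISITED l).
    have [h1 h2] := hv l k.
    rewrite /s2 /update /= hr fr // sL addn1.
    case: eqP => [->|lE]; split=> [ki|].
    - by split=> //; apply: lf_mono => //; lia.
    - by [].
    - by have [] := h1 ki; lia.
    - move=> ki lk; apply: h2 => //; have [kE|] := eqVneq k i; last by lia.
      by case: lE; rewrite -lk kE.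
  have hb2 : s2 BASE 0 = \sum_(0 <= j < i.+1) ((rt j).+1 - lf j).
    by rewrite big_nat_recr //= -hb /s2 /update /= hr !(fr RIGHT, fr LEFT) // sR sL addn1.
  have srcS : sources i.+1 = sources i ++ (if lf i == 1 then [:: i] else [::]).
    by rewrite /sources -[i.+1]addn1 iotaD filter_cat /=.
  have fr2 a : a \notin [:: BASE; VISITED] -> s2 a = s1 a.
    by rewrite !inE !negb_or => /andP[? ?]; rewrite /s2 !update_ne.
  move: s2 => s2 in s2L s2W hv2 hb2 fr2 *.
  rewrite -!(fr2 TAIL, fr2 QUEUE, fr2 LABEL, fr2 COUNT) // in htl hq hl hc.
  apply: wp_if; rewrite /= s2L s2W => lE.
    have lf1 : lf i == 1 by lia.
    rewrite lf1 in srcS.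
    do !(apply: wp_seq; apply: wp_write); do 2 apply: wp_write.
    rewrite /= srcS /update /= s2W htl; split.
    + by split; lia.
    + exact: hb2.
    + split=> [|k]; first by rewrite size_cat.
      rewrite size_cat /= nth_cat => ki; case: eqP => [->|kt].
        by rewrite ltnn subnn.
      by rewrite ifT ?hq //; lia.
    + by split=> k; rewrite mem_cat inE ?hl ?hc orbC; case: eqP.
    + exact: hv2.
  have lf1 : lf i != 1 by lia.
  rewrite (negbTE lf1) cats0 in srcS.
  apply: wp_skip; apply: wp_write; rewrite /= srcS /update /= s2W.
  by split=> //; lia.
- move=> t s1 [[ht hr] hb [htl hq] [hl hc] hv] fr.
  rewrite /= in fr.
  split; first by rewrite /= (fr SIZE) // sn hr subnn.
  apply: wp_seq; apply: wp_write => /=.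
  apply: wp_seq; apply: wp_write => /=.
  set s2 := update _ _ _ _.
  have fr2 a : a \notin [:: BASE; ROW] -> s2 a = s1 a.
    by rewrite !inE !negb_or => /andP[? ?]; rewrite /s2 !update_ne.
  have s2N : s2 BASE 0 = N.
    by rewrite /s2 /update /= hb (fr SIZE) // sn NE addnA.
  have s2W : s2 ROW 0 = 0 by [].
  have s2M k : s2 MULT k = 0 by rewrite fr2 // fr // s0.
  move: s2 => s2 in fr2 s2N s2W s2M *.
  apply: (@wp_while (fun i t s1 =>
    [/\ t <= 50 * i, s1 ROW 0 = i & forall k, k <= i -> s1 MULT k = k * N]) N).
  + by split=> // k; rewrite leqn0 s2M => /eqP->.
  + move=> i t2 s3 iN [ht2 hr2 hm] fr3; rewrite /= in fr3.
    split; first by rewrite /= (fr3 BASE) // s2N hr2; lia.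
    apply: wp_seq; apply: wp_write; apply: wp_write.
    rewrite /update /= hr2 (fr3 BASE) // s2N; split=> [||k ki]; [by lia | by lia |].
    case: eqP => [->|kt]; first by rewrite addn1 hm // mulSn addnC.
    by rewrite hm //; lia.
  + move=> t2 s3 [ht2 hr2 hm] fr3; rewrite /= in fr3.
    split; first by rewrite /= (fr3 BASE) // s2N hr2 subnn.
    have fr23 a : a \notin [:: BASE; ROW; MULT] -> s3 a = s1 a.
      by rewrite !inE !negb_or => /and3P[? ? ?]; rewrite fr3 ?fr2 ?inE ?negb_or //; apply/andP.
    split=> [|||k|k|k|k|k|l l1|].
    * by rewrite NE in ht2 *; rewrite /=; lia.
    * by rewrite fr23 // fr // s0.
    * by rewrite fr23.
    * by rewrite fr23 //; apply: hq.
    * by rewrite fr23.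
    * by rewrite fr23.
    * by rewrite fr23 // fr // s0.
    * by rewrite fr23 // fr // s0.
    * rewrite !fr23 //; split=> k; first by have [] := hv l k.
      move=> kn lk; rewrite hl; have [_ /(_ kn lk) ->] := hv l k.
      by rewrite /sources mem_filter lk (gtn_eqF l1).
    * by split; rewrite ?(fr23 LEFT, fr23 RIGHT, fr LEFT, fr RIGHT, fr3 BASE).
Qed.

End Body.

(** * Closed form of an iteration *)

(** The vertex [x] never selects itself and each [j] occurs once, so all tests and additions can be
    evaluated in the initial state [st]. *)
Lemma foldl_visit (G : bigraph) (x : 'I_(nX G)) (st : state G) (s : seq 'I_(nX G)) :
  uniq s ->
  let l := label_succ (labels st x) in
  let sel (j : 'I_(nX G)) := [&& x < j, left x < left j, left j <= (right x).+1,
                   right x < right j & label_le l (labels st j)] in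
  let st' := foldl (visit x) st s in
  [/\ queue st' = queue st ++
        [seq j <- s | [&& sel j, ~~ label_le (labels st j) l & j \notin queue st]],
      forall j, labels st' j = if (j \in s) && sel j then l else labels st j
    & forall j, counts st' j =
        if (j \in s) && sel j then counts st j + counts st x else counts st j].
Proof.
move=> us l sel; elim/last_ind: s us => [|s j IH] /=.
  by rewrite cats0.
rewrite rcons_uniq => /andP[js us]; have [hq hl hc] := IH us.
have selx : sel x = false by rewrite /sel ltnn.
rewrite foldl_rcons filter_rcons; move: (foldl _ _ _) => st1 in hq hl hc *.
have lx : labels st1 x = labels st x by rewrite hl selx andbF.
have cx : counts st1 x = counts st x by rewrite hc selx andbF.
have lj : labels st1 j = labels st j by rewrite hl (negbTE js).
have cj : counts st1 j = counts st j by rewrite hc (negbTE js).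
have qj : (j \in queue st1) = (j \in queue st).
  by rewrite hq mem_cat mem_filter (negbTE js) andbF orbF.
rewrite /visit lx lj -/l -/(sel j) qj cj cx.
case selj : (sel j) => /=; split.
- by case: ifP => _; rewrite hq // rcons_cat.
- move=> i; rewrite ffunE mem_rcons inE; case: eqP => [->|_]; first by rewrite selj.
  exact: hl.
- move=> i; rewrite ffunE mem_rcons inE; case: eqP => [->|_]; first by rewrite selj.
  exact: hc.
- exact: hq.
- move=> i; rewrite mem_rcons inE hl; case: eqP => [->|_] //=; by rewrite (negbTE js) selj.
- move=> i; rewrite mem_rcons inE hc; case: eqP => [->|_] //=; by rewrite (negbTE js) selj.
Qed.

(** * Neighbourhoods and edges *)

Section Intervals.

Variable G : bigraph.
Implicit Types (x : 'I_(nX G)) (y : 'I_(nY G)).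

Lemma left_le x y : adj x y -> left x <= y.+1.
Proof.
move=> xy; rewrite /left; have := mem_index_enum y.
elim: (index_enum _) => // z s IH; rewrite inE big_cons => /predU1P[<-|/IH le_y].
  by rewrite xy geq_minl.
by case: ifP => // _; rewrite geq_min le_y orbT.
Qed.

Lemma right_ge x y : adj x y -> y.+1 <= right x.
Proof. by move=> xy; apply: (leq_bigmax_cond (F := fun y : 'I__ => y.+1)). Qed.

Lemma left_adj x y : adj x y -> exists2 y', adj x y' & left x = y'.+1.
Proof.
move=> xy; have : left x = nY G \/ exists2 y', adj x y' & left x = y'.+1.
  apply: (big_ind (fun z => z = nY G \/ exists2 y', adj x y' & z = y'.+1)); [by left | | by move=> y' ?; right; exists y'].
  by move=> a b ha hb; rewrite /minn; case: ifP.
(* If the minimum equals the default [nY G], then [y] itself attains it, because [y.+1 <= nY G]. *)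
case=> // lE; exists y => //; apply/eqP; rewrite eqn_leq left_le //= lE.
exact: ltn_ord.
Qed.

Lemma right_adj x y : adj x y -> exists2 y', adj x y' & right x = y'.+1.
Proof.
move=> xy; have : right x = 0 \/ exists2 y', adj x y' & right x = y'.+1.
  apply: (big_ind (fun z => z = 0 \/ exists2 y', adj x y' & z = y'.+1)); [by left | | by move=> y' ?; right; exists y'].
  by move=> a b ha hb; rewrite /maxn; case: ifP.
by case=> // r0; have := right_ge xy; rewrite r0.
Qed.

Lemma right_le x : right x <= nY G.
Proof. by apply/bigmax_leqP => y _; apply: ltn_ord. Qed.

Lemma sum_interval m a b : b <= m -> \sum_(y < m) (a <= y < b) = b - a.
Proof.
move=> bm; suff -> : \sum_(y < m) (a <= y < b) = minn b m - a by lia.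
elim: m {bm} => [|m IH]; first by rewrite big_ord0; lia.
by rewrite big_ord_recr /= IH; case: (boolP (a <= m < b)) => /= ?; lia.
Qed.

(** Convexity fills the interval between the extreme neighbours. Ordinals start at 0 and [left],
    [right] at 1, hence the shift in the proof. *)
Lemma degree x y : convex_order G -> adj x y ->
  \sum_(y < nY G) adj x y = (right x).+1 - left x.
Proof.
move=> conv xy; have [y1 xy1 lE] := left_adj xy; have [y2 xy2 rE] := right_adj xy.
rewrite (_ : _ - _ = right x - (left x).-1); last by lia.
rewrite -(sum_interval _ (right_le x)); apply: eq_bigr => y' _; congr nat_of_bool.
apply/idP/idP => [xy'|/andP[ly yr]].
  by have := left_le xy'; have := right_ge xy'; lia.
by apply: (conv x y1 y' y2) => //; lia.
Qed.

Lemma nE_sum : nE G = \sum_(x < nX G) \sum_(y < nY G) adj x y.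
Proof.
rewrite /nE -sum1_card pair_bigA big_mkcond.
by apply: eq_bigr => p _; rewrite inE; case: adj.
Qed.

(** A vertex with neighbours contributes its degree; one without has [right x = 0] and contributes
    at most 1, whence the term [nX G]. *)
Lemma sum_lengths : convex_order G ->
  \sum_(x < nX G) ((right x).+1 - left x) <= nE G + nX G.
Proof.
move=> conv; rewrite nE_sum -[X in _ + X]card_ord -sum1_card -big_split /=.
apply: leq_sum => x _; have [/existsP[y xy]|none] := boolP [exists y, adj x y].
  by rewrite (degree conv xy) leq_addr.
rewrite /right big1 => [|y xy]; [lia | by case/existsP: none; exists y].
Qed.

Lemma exists_neighbour (u v : 'I_(nX G) + 'I_(nY G)) :
  connected G -> u != v -> exists w, edge u w.
Proof.
move=> conn uv; have /connectP[[|w p] /= pth vE] := conn u v.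
  by rewrite vE eqxx in uv.
by case/andP: pth => uw _; exists w.
Qed.

Lemma has_neighbourX x : connected G -> 0 < nY G -> exists y, adj x y.
Proof.
move=> conn Y0; have [|[x'|y] //= xy] := @exists_neighbour (inl x) (inr (Ordinal Y0)) conn.
  by [].
by exists y.
Qed.

Lemma has_neighbourY y : connected G -> 0 < nX G -> exists x, adj x y.
Proof.
move=> conn X0; have [|[x|y'] //= xy] := @exists_neighbour (inr y) (inl (Ordinal X0)) conn.
  by [].
by exists x.
Qed.

(** Double counting: the sum of the degrees counts each vertex of Y at least once, by
    connectedness. *)
Lemma nY_le_sum : connected G -> convex_order G -> 0 < nX G ->
  nY G <= \sum_(x < nX G) ((right x).+1 - left x).
Proof.
move=> conn conv X0; have [Y0|Y0] := posnP (nY G); first by rewrite Y0.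
rewrite -[X in X <= _]card_ord -sum1_card.
have -> : \sum_(x < nX G) ((right x).+1 - left x) = \sum_(x < nX G) \sum_(y < nY G) adj x y.
  by apply: eq_bigr => x _; have [y /(degree conv)] := has_neighbourX x conn Y0.
rewrite exchange_big; apply: leq_sum => y _ /=.
have [x xy] := has_neighbourY y conn X0.
by rewrite (bigD1 x) //= xy.
Qed.

Lemma first_nbrE x : connected G -> first_nbr x = (left x == 1).
Proof.
move=> conn; apply/existsP/eqP => [[y /andP[/eqP y0 xy]]|l1].
  have := left_le xy; rewrite y0; have [y' _ ->] := left_adj xy; lia.
(* With Y empty, [left x] is the default [nY G], which is 0 and not 1. *)
have [Y0|Y0] := posnP (nY G).
  have := l1; rewrite /left big_pred0; last by case=> y yY; exfalso; rewrite Y0 in yY.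
  by move=> Y1; rewrite Y1 in Y0.
have [y xy] := has_neighbourX x conn Y0; have [y' xy' lE] := left_adj xy.
by exists y'; rewrite xy' andbT -eqSS -lE l1.
Qed.

Lemma left_bounds x : connected G -> 0 < nY G -> 0 < left x <= right x.
Proof.
move=> conn Y0; have [y xy] := has_neighbourX x conn Y0.
have [y' xy' ->] := left_adj xy; exact: right_ge.
Qed.

End Intervals.

Lemma tabulateE m (f : 'I_m -> nat) (i : 'I_m) : tabulate f i = f i.
Proof. by rewrite /tabulate valK. Qed.

Lemma pairwise_const (T : eqType) (f : T -> nat) c s :
  {in s, forall i, f i = c} -> pairwise leq (map f s).
Proof.
elim: s => //= i s IH h; rewrite IH ?andbT; last by move=> j js; rewrite h // inE js orbT.
by apply/allP => _ /mapP[j js ->]; rewrite !h ?inE ?js ?eqxx ?orbT.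
Qed.

(** Uniqueness of digits in base [N], used twice; the leading coefficient is unbounded. *)
Lemma eq_address N c c' l l' r r' : l < N -> l' < N -> r < N -> r' < N ->
  (c * (N * N) + (l * N + r) == c' * (N * N) + (l' * N + r')) =
  [&& c == c', l == l' & r == r'].
Proof.
move=> lN lN' rN rN'; apply/eqP/and3P => [|[/eqP-> /eqP-> /eqP->] //].
have digit a b d d' : d < N -> d' < N -> a * N + d = b * N + d' -> a = b /\ d = d'.
  move=> dN dN' E; have N0 : 0 < N by lia.
  have := congr1 (divn^~ N) E; have := congr1 (modn^~ N) E.
  by rewrite !modnMDl !divnMDl // !modn_small // !divn_small // !addn0.
rewrite !mulnA !addnA -!mulnDl => /digit[] // /digit[] // -> -> ->.
by split.
Qed.

(** * The loop invariant *)

Section Procedure.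

Variable G : bigraph.
Hypotheses (conn : connected G) (conv : convex_order G) (lexG : lex_convex_order G).

Local Notation n := (nX G).
Local Notation lf := (tabulate (@left G)).
Local Notation rt := (tabulate (@right G)).
(** The sum is at least [nY G] by [nY_le_sum], so the indices of rows and columns stay below it, and
    it is linear by [sum_lengths]. *)
Definition base := \sum_(0 <= i < n) ((rt i).+1 - lf i) + n + 2.
Local Notation N := base.

Implicit Types (x j : 'I_n).

Lemma tabulate_lex i k : i < k -> k < n -> lf i < lf k \/ (lf i = lf k /\ rt i <= rt k).
Proof.
move=> ik kn; have := lexG (i := Ordinal (ltn_trans ik kn)) (j := Ordinal kn) ik.
by rewrite -!(tabulateE (@left G), tabulateE (@right G)).
Qed.

Lemma base_sum : N = \sum_(x < n) ((right x).+1 - left x) + n + 2.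
Proof. by rewrite /base big_mkord; congr (_ + _ + _); apply: eq_bigr => i _; rewrite !tabulateE. Qed.

(** Labels are codes, 0 being infinity. [inv_sorted], [inv_bound] and [inv_done] are the
    breadth-first invariants: a vertex changes its label only from infinity, hence enters the queue
    once. *)
Record invariant (st : state G) (s : store) : Prop := Invariant {
  inv_represents : represents st s;
  inv_uniq : uniq (queue st);
  inv_labelled x : x \in queue st -> 0 < s LABEL x;
  inv_sorted : pairwise leq [seq s LABEL (val x) | x <- queue st];
  inv_bound x q j : queue st = x :: q -> s LABEL j <= (s LABEL x).+1;
  inv_done x q j : queue st = x :: q -> j \notin queue st -> s LABEL j <= s LABEL x;
  inv_keys j : s KEY j = (s LABEL j).-1 * (N * N);
  inv_waiting j : j \in queue st -> counts st j = gathered N lf rt s j;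
  (* keeps [inv_waiting] true when [j] enters the queue *)
  inv_unseen j : s LABEL j = 0 -> counts st j = 0 /\
    forall c r, r < rt j -> s ACC (c * (N * N) + (lf j * N + r)) = 0;
  inv_pointers : visited_ok n lf (s VISITED) (s LABEL);
  inv_arrays : tables N lf rt s }.

(** Amortised cost: a vertex releases one unit when it is labelled and the rest, its length plus a
    constant, when it is dequeued. *)
Definition weight (st : state G) (s : store) j :=
  if s LABEL j == 0 then right j - left j + 3
  else if j \in queue st then right j - left j + 2 else 0.

Definition potential st s := \sum_(j < n) weight st s j.

Hypothesis Y0 : 0 < nY G.

Lemma tabulate_bounds k : k < n -> 0 < lf k <= rt k.
Proof. by move=> kn; rewrite -[k]/(val (Ordinal kn)) !tabulateE left_bounds. Qed.

Lemma right_lt_base k : k < n -> (rt k).+1 < N.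
Proof.
move=> kn; have X0 : 0 < n by lia.
have := nY_le_sum conn conv X0; have := right_le (Ordinal kn).
by rewrite base_sum -(tabulateE (@right G)) /=; lia.
Qed.

(** The drop of the potential pays for the body; the extra 400 pays for the loop test and makes the
    drop strict. *)
Lemma step_spec st s x q :
  invariant st s -> queue st = x :: q ->
  wp body s (fun t s' => invariant (iteration st x q) s' /\
    t + 400 * potential (iteration st x q) s' + 400 <= 400 * potential st s).
Proof.
move=> inv qE.
have lf0 k (kn : k < n) : 0 < lf k by case/andP: (tabulate_bounds kn).
have lfrt k (kn : k < n) : lf k <= rt k by case/andP: (tabulate_bounds kn).
case: inv => [[rT rQ rL rC] iu il isrt ib id ik iw iun ip ia].
have hd : next_vertex s = x.
  by have := rQ 0; rewrite qE addn0; apply.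
apply: (wp_conseq (body_spec tabulate_lex lf0 lfrt right_lt_base (ltn_ord x) ia ip hd)).
move=> t s' _ [pt pH pT pQ pL pK pC pA pV pTb].
have xq : x \in queue st by rewrite qE mem_head.
have lx0 := il _ xq.
have {}ib j := ib _ _ j qE; have {}id j := id _ _ j qE.
have [k lxE] : exists k, labels st x = Some k.
  by move: lx0; rewrite rL; case: (labels st x) => // k _; exists k.
have sLx : s LABEL x = k.+1 by rewrite rL lxE.
set nw := news n lf rt (s LABEL) x (rt x).+2 in pt pT pQ pL pK.
(* By [inv_bound] no code exceeds [k.+2], so the label test of [visit] leaves only infinity and the
   next label. *)
pose sel (j : 'I_n) := arc lf rt x j && ((s LABEL j == 0) || (s LABEL j == k.+2)).
have arcE (i j : 'I_n) : arc lf rt i j = [&& left i < left j, left j <= (right i).+1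
                                            & right i < right j].
  by rewrite /arc !tabulateE.
have arc_lt j : arc lf rt x j -> x < j.
  by case/and3P=> h _ _; apply: (lf_lt tabulate_lex).
have mem_nw j : (val j \in nw) = arc lf rt x j && (s LABEL j == 0).
  rewrite mem_news ltn_ord /= andbC; case: (boolP (arc _ _ _ _)) => //= /and3P[_ h _].
  by rewrite ltnS h.
have xnw : (val x \in nw) = false by rewrite mem_nw /arc ltnn.
have selE j : [&& x < j, left x < left j, left j <= (right x).+1, right x < right j &
    label_le (Some k.+1) (labels st j)] = sel j.
  rewrite /sel; have := ib j; rewrite sLx !rL; case: (boolP (arc _ _ _ _)) => [a|].
    rewrite (arc_lt _ a); move: a; rewrite arcE => /and3P[-> -> ->] /=.
    by case: (labels st j) => //= m; rewrite eqn_leq !ltnS => ->.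
  by rewrite arcE => /and3P na _; apply/negbTE/negP => /and5P[_ h1 h2 h3 _]; case: na.
have [] := foldl_visit x (State q (labels st) (counts st)) (enum_uniq 'I_n).
rewrite /= -/(iteration st x q) lxE /=.
set st' := iteration st x q => hq0 hl0 hc0.
have hl j : labels st' j = if sel j then Some k.+1 else labels st j.
  by rewrite hl0 mem_enum selE.
have hc j : counts st' j = if sel j then counts st j + counts st x else counts st j.
  by rewrite hc0 mem_enum selE.
(* A vertex whose label decreases was unlabelled, hence not in the queue, so the membership test of
   [visit] agrees with [news]. *)
have [nw' hq nwE] : exists2 nw', queue st' = q ++ nw' & map val nw' = nw.
  rewrite hq0; eexists; first by reflexivity.
  rewrite /nw /news -val_enum_ord filter_map; congr map; apply: eq_filter => j.
  have := mem_nw j; rewrite /nw mem_news ltn_ord /= selE => ->.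
  have jq : j \in q -> 0 < s LABEL j by move=> jq; apply: il; rewrite qE inE jq orbT.
  rewrite /sel; case: (arc _ _ _ _) => //=; move: jq; rewrite rL.
  case: (labels st j) => [m|] /= jq; last by case: (j \in q) jq => // /(_ isT).
  by case: eqP => //= -[->]; rewrite leqnn.
have mem_nw' j : (j \in nw') = (val j \in nw) by rewrite -nwE mem_map //; apply: val_inj.
move: st' hq hl hc {hq0 hl0 hc0} => st' hq hl hc.
have {}pL j : s' LABEL j = if val j \in nw then k.+2 else s LABEL j by rewrite pL sLx.
have keep j : 0 < s LABEL j -> s' LABEL j = s LABEL j.
  by move=> lj; rewrite pL mem_nw; case: eqP lj => [->|]; rewrite ?andbF.
have keep_q j : j \in q -> s' LABEL j = s LABEL j.
  by move=> jq; rewrite keep // il // qE inE jq orbT.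
have [xq' uq] : x \notin q /\ uniq q by move: iu; rewrite qE => /andP[].
have lab_queue j : j \in queue st' -> k < s' LABEL j.
  rewrite hq mem_cat => /orP[jq|]; last by rewrite mem_nw' pL => ->.
  rewrite keep_q //; move: isrt; rewrite qE /= => /andP[/allP h _].
  by rewrite -sLx; apply: h; apply: map_f.
have in_queue j : (j \in queue st') = (j \in q) || (val j \in nw).
  by rewrite hq mem_cat mem_nw'.
have cntx : counts st x = gathered N lf rt s x by apply: iw.
have rt_N j : rt j < N by apply: ltnW; apply: right_lt_base.
have lf_N j : lf j < N by apply: leq_ltn_trans (lfrt j _) (rt_N j).
have mem_t c l r : l < N -> r < N ->
    (c * (N * N) + (l * N + r) \in targets N lf rt (s KEY x) x (rt x).+2) =
    [&& c == k.+1, lf x < l <= (rt x).+1 & r == rt x].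
  have NN : s KEY x + N * N = k.+1 * (N * N) by rewrite ik sLx mulSn addnC.
  move=> lN rN; apply/mapP/and3P => [[i]|[/eqP-> il' /eqP->]].
    rewrite mem_index_iota /address NN => il' /eqP.
    have iN : i < N by have := right_lt_base (ltn_ord x); lia.
    by rewrite eq_address // => /and3P[-> /eqP-> ->]; split=> //; lia.
  by exists l; [rewrite mem_index_iota; lia | rewrite /address NN].
(* Among the cells read for [j], only that of column [rt x] can change; it lies in the range of
   summation exactly when [lf j <= rt x + 1] and [rt x < rt j]. *)
have gatheredE j : gathered N lf rt s' j =
    s' COUNT j +
    \sum_((lf j).-1 <= r < rt j) s ACC ((s' LABEL j).-1 * (N * N) + (lf j * N + r)) +
    (if ((s' LABEL j).-1 == k.+1) && arc lf rt x j then counts st x else 0).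
  rewrite /gathered -addnA; congr (_ + _).
  have -> : s' KEY j = (s' LABEL j).-1 * (N * N).
    rewrite pK pL !ik sLx; case: ifP => // _ /=.
    by rewrite mulSn addnC.
  pose hit := ((s' LABEL j).-1 == k.+1) && (lf x < lf j <= (rt x).+1).
  have -> : (if ((s' LABEL j).-1 == k.+1) && arc lf rt x j then counts st x else 0) =
      \sum_((lf j).-1 <= r < rt j | r == rt x) (if hit then counts st x else 0).
    rewrite big_nat1_eq /hit /arc; have := lf0 j (ltn_ord j).
    by case: (_ == k.+1) => //= lj0; repeat case: ifP => ?; lia.
  rewrite [X in _ = _ + X]big_mkcond -big_split /=; apply: eq_big_nat => r rj.
  rewrite pA -cntx mem_t //; last by have := rt_N j; lia.
  rewrite andbA -/hit; congr (_ + _); rewrite [(hit && _)]andbC.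
  by case: (r == _).
split; first split.
- split.
  + by rewrite pT rT pH qE hq size_cat -nwE size_map /=; lia.
  + move=> i; rewrite hq size_cat -(size_map val nw') nwE map_cat nwE nth_cat size_map pQ pH.
    have := rQ i.+1; rewrite rT qE /= => rQi iq.
    case: (ltnP i (size q)) => iq'; first by rewrite ifF ?addSnnS ?rQi //; lia.
    rewrite ifT; last by lia.
    congr nth; lia.
  + move=> j; rewrite pL hl rL /sel mem_nw rL; case: (arc _ _ _ _) => //=.
    by case: (labels st j) => //= m; case: eqP => // -[->].
  (* The count of [x] has just been collected. Any other vertex outside the new queue is not
     selected, since [inv_done] excludes the code [k.+2]. *)
  + move=> j; rewrite in_queue negb_or => /andP[jq jn].
    rewrite pC hc; case: eqP => [/val_inj->|jx].
      by rewrite -cntx /sel /arc ltnn.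
    have jq' : j \notin queue st by rewrite qE inE negb_or jq andbT; apply: contra_notN jx => /eqP->.
    have := id j jq'; rewrite rC // sLx => lj.
    rewrite ifF //; apply/negbTE; apply: contra jn.
    by rewrite mem_nw => /andP[-> /=]; lia.
- rewrite hq cat_uniq uq -(map_inj_uniq val_inj) nwE filter_uniq ?iota_uniq // andbT.
  apply/hasPn => j; rewrite mem_nw' mem_nw => /andP[_ /eqP lj]; apply/negP => jq.
  by have := il j; rewrite lj qE inE jq orbT => /(_ isT).
- by move=> j /lab_queue; lia.
(* Old codes are at most [k.+2], and the new vertices all have this code. *)
- rewrite hq map_cat pairwise_cat; apply/and3P; split.
  + apply/allrelP => _ _ /mapP[i iq ->] /mapP[j jn ->].
    by rewrite keep_q // pL -mem_nw' jn -sLx ib.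
  + move: isrt; rewrite qE /= => /andP[_].
    have /eq_in_map -> // : {in q, (fun j => s' LABEL (val j)) =1 (fun j => s LABEL (val j))}.
    exact: keep_q.
  + by apply: (@pairwise_const _ _ k.+2) => j; rewrite mem_nw' pL => ->.
- move=> z q' j qE'; have := lab_queue z; rewrite qE' mem_head => /(_ isT) lz.
  by rewrite pL; case: ifP => _; [lia | have := ib j; lia].
- move=> z q' j qE'; have := lab_queue z; rewrite {1}qE' mem_head => /(_ isT) lz.
  rewrite in_queue negb_or pL => /andP[jq /negbTE ->].
  have [->|jx] := eqVneq j x; first by lia.
  have := id j; rewrite qE inE negb_or jx jq => /(_ isT); lia.
- move=> j; rewrite pK pL !ik sLx; case: ifP => // _ /=.
  by rewrite mulSn addnC.
(* For a newly labelled [j], the cells were 0 by [inv_unseen], and only the contribution of [x]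
   remains. For an older one, both sides grow alike. *)
- move=> j jq; rewrite gatheredE hc.
  have jx : (val j == val x) = false.
    by apply/eqP => /val_inj jx; move: jq; rewrite in_queue jx xnw (negbTE xq').
  rewrite pC jx pL; have := jq; rewrite in_queue.
  case: (boolP (val j \in nw)) => jn; rewrite ?orbT ?orbF => jq'.
    have /andP[a lj] : arc lf rt x j && (s LABEL j == 0) by rewrite -mem_nw.
    have [c0 a0] := iun j (eqP lj).
    have jnq : j \notin queue st by apply/negP => /il; rewrite (eqP lj).
    rewrite /sel a lj eqxx /= rC // c0 add0n big_nat big1 // => r rj.
    by apply: a0; lia.
  have jq2 : j \in queue st by rewrite qE inE jq' orbT.
  have := il j jq2; move: jn; rewrite mem_nw /sel iw // /gathered ik.
  case: (s LABEL j) => // m jn _; rewrite /= !eqSS [X in _ = _ + (if X then _ else _)]andbC.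
  by case: ifP; rewrite ?addn0.
(* A vertex still unlabelled is not reached from [x], so [x] writes to none of its cells. *)
- move=> j; rewrite pL; case: ifP => // jn lj.
  have [c0 a0] := iun j lj.
  have na : arc lf rt x j = false by apply/negbTE; move: jn; rewrite mem_nw lj andbT => ->.
  rewrite hc /sel na; split=> // c r rj.
  rewrite pA a0 // mem_t //; last by have := rt_N j; lia.
  by case: ifP => // /and3P[_ h1 /eqP h2]; move: na; rewrite /arc; lia.
- exact: pV.
- exact: pTb.
have szn : size nw = \sum_(j < n) (val j \in nw).
  have unw : uniq nw' by rewrite -(map_inj_uniq val_inj) nwE filter_uniq ?iota_uniq.
  rewrite -nwE size_map -(card_uniqP unw) -sum1_card big_mkcond nwE.
  by apply: eq_bigr => j _; rewrite mem_nw'; case: (_ \in _).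
have split_pot j : weight st' s' j + (if j == x then right x - left x + 2 else 0) + (val j \in nw) = weight st s j.
  rewrite /weight in_queue pL qE inE.
  have := il j; rewrite qE inE; have := mem_nw j.
  have [->|jx] := eqVneq j x.
    by rewrite xnw (negbTE xq') sLx /= addn0.
  case: (val j \in nw) => /=.
    by move/esym/andP => [_ ->] _; rewrite orbT addn0; lia.
  by rewrite orbF !addn0.
have -> : potential st s = potential st' s' + (right x - left x + 2) + size nw.
  rewrite szn /potential -(eq_bigr _ (fun j _ => split_pot j)) !big_split /=; congr (_ + _ + _).
  by rewrite -big_mkcond big_pred1_eq.
by move: pt; rewrite !tabulateE; lia.
Qed.

(** Induction on the potential, which gives termination and the time bound together; the 6 is the
    cost of the last test. *)
Lemma loop_spec st s :
  invariant st s -> exists2 t, realizes body st s t & t <= 400 * potential st s + 6.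
Proof.
have [m] := ubnP (potential st s); elim: m st s => // m IH st s pm inv.
case qE: (queue st) => [|x q].
  exists 6; last exact: leq_addl.
  exact: (realizes_stop _ (inv_represents inv)).
have [t [s' [ex [inv' ht]]]] := step_spec inv qE.
have [|t' re ht'] := IH _ _ _ inv'; first by lia.
exists ((cost queue_nonempty).+1 + t + t'); last by rewrite /=; lia.
exact: realizes_step (inv_represents inv) qE ex re.
Qed.

End Procedure.

(** * The invariant and the potential after initialisation *)

Section Start.

Variable G : bigraph.
Hypotheses (conn : connected G) (conv : convex_order G).

Local Notation n := (nX G).
Local Notation lf := (tabulate (@left G)).
Local Notation rt := (tabulate (@right G)).

Variables (t : nat) (s : store).
Hypothesis set_up : setup_post n (base G) lf rt t s.

Lemma mem_sources (x : 'I_n) : (val x \in sources lf n) = first_nbr x.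
Proof. by rewrite mem_filter mem_iota ltn_ord /= andbT tabulateE first_nbrE. Qed.

Lemma init_represents : represents (init_state G) s.
Proof.
have srcE : map val (queue (init_state G)) = sources lf n.
  rewrite /sources -val_enum_ord filter_map; congr map.
  by apply: eq_filter => x; rewrite /= tabulateE first_nbrE.
have szE : size (queue (init_state G)) = size (sources lf n) by rewrite -srcE size_map.
split.
- by rewrite szE (setup_head set_up) (setup_tail set_up).
- by move=> k; rewrite szE srcE (setup_head set_up); apply: setup_queue set_up k.
- by move=> x; rewrite (setup_label set_up) mem_sources ffunE; case: ifP.
- by move=> x _; rewrite (setup_count set_up) mem_sources ffunE; case: ifP.
Qed.

Lemma init_invariant : invariant (init_state G) s.
Proof.
have inq (x : 'I_n) : (x \in queue (init_state G)) = first_nbr x.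
  by rewrite mem_filter mem_enum andbT.
have labE (x : 'I_n) : s LABEL x = first_nbr x by rewrite (setup_label set_up) mem_sources.
split.
- exact: init_represents.
- by rewrite filter_uniq ?enum_uniq.
- by move=> x; rewrite inq labE => ->.
- by apply: (@pairwise_const _ _ 1) => x; rewrite inq labE => ->.
- by move=> x q j _; rewrite !labE; case: first_nbr.
- move=> x q j qE _; rewrite !labE.
  by have -> : first_nbr x; [rewrite -inq qE mem_head | case: first_nbr].
- by move=> j; rewrite labE (setup_key set_up); case: first_nbr.
- move=> j; rewrite inq => fj; rewrite /gathered (setup_count set_up) mem_sources ffunE fj.
  by rewrite big1 // => r _; rewrite (setup_acc set_up).
- move=> j; rewrite labE ffunE; case: first_nbr => // _.
  by split=> // c r _; rewrite (setup_acc set_up).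
- exact: setup_visited set_up.
- exact: setup_tables set_up.
Qed.

Lemma init_potential : potential (init_state G) s <= nE G + 4 * n.
Proof.
apply: (@leq_trans (\sum_(x < n) (((right x).+1 - left x) + 3))).
  by apply: leq_sum => x _; rewrite /weight; repeat case: ifP => _; lia.
rewrite big_split /= sum_nat_const card_ord.
by apply: leq_trans (leq_add (sum_lengths conv) (leqnn _)) _; lia.
Qed.

End Start.

(* The [+ 1] only matters when X is empty. *)
Theorem theorem3 :
  exists (setup body : cmd) (c : nat), forall G : bigraph,
    connected G -> convex_order G -> lex_convex_order G ->
    exists (t0 t1 : nat) (s : store),
      [/\ exec setup (input G) t0 s,
          realizes body (init_state G) s t1
        & t0 + t1 <= c * (nX G + nE G + 1)].
Proof.
(* The bounds below add up to [600 * nE G + 2000 * nX G + 406]. *)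
exists setup, body, 2100 => G conn conv lexG.
have [t0 [s [ex su]]] : wp setup (input G) (setup_post (nX G) (base G)
    (tabulate (@left G)) (tabulate (@right G))).
  apply: setup_spec => //; first exact: tabulate_lex.
  by case=> [|[|[|a]]].
have t0_le : t0 <= 200 * (nE G + 2 * nX G + 2).
  by have := setup_time su; have := sum_lengths conv; rewrite base_sum; lia.
suff [t1 re t1_le] : exists2 t1, realizes body (init_state G) s t1 &
    t1 <= 400 * (nE G + 4 * nX G) + 6 by exists t0, t1, s; split=> //; lia.
(* With Y empty the bound [0 < left x] fails, but the initial queue is empty and the loop stops at
   once. *)
have [Y0|Y0] := posnP (nY G).
  exists 6; last exact: leq_addl.
  apply: (realizes_stop _ (init_represents conn su)).
  apply/eqP; rewrite -(negbK (_ == _)) -has_filter; apply/hasPn => x _.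
  by apply/existsP => -[y]; case: y => y yY; exfalso; rewrite Y0 in yY.
have [t1 re ht] := loop_spec conn conv lexG Y0 (init_invariant conn su).
by exists t1 => //; have := init_potential conv s; lia.
Qed.
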